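(* There exists a $2$-edge-connected graph $G$ (with a destination $t\in V(G)$) for which no $1$-resilient routing scheme against dynamic failures can exist if each node $v\in V(G)$ uses a link-circular routing function.
   Context: Connectivity is edge-connectivity. Dynamic failures: a set $F\subseteq E$ of unstable links; each link of $F$ may alternate arbitrarily between up and down over time (when down it fails in both directions), including while a packet travels; links outside $F$ are always up. Routing scheme: for destination $t$, every node $v\ne t$ has a static deterministic forwarding function whose input is the in-port of the packet (or $\bot$ if the packet originates at $v$) and the set of links incident to $v$ that are currently up, and whose output is an outgoing link at $v$. No packet header rewriting and no knowledge of the source is used. A routing scheme for $t$ is $k$-resilient against dynamic failures if for every set $F$ of dynamic failures with $|F|\le k$, every packet originating at a node $s$ that is connected to $t$ in $G\setminus F$ (the graph with all of $F$ removed) is delivered to $t$, however the states of the links of $F$ evolve. Link-circular: the forwarding function at $v$ is link-circular if there is an ordered circular sequence $\langle u_1,\dots,u_\ell\rangle$ of the neighbors of $v$ such that a packet received from $u_i$ is forwarded to $u_{i+1}$; if the link $\{v,u_{i+1}\}$ is down, then to $u_{i+2}$, and so on, with $u_1$ following $u_\ell$. (So a packet is bounced back to its sender only if all other incident links are down. The choice of out-port for packets originating at $v$ is an arbitrary function of the set of up links at $v$.) *)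

(* Defs.v *)
From mathcomp Require Import all_boot.

Set Implicit Arguments.
Unset Strict Implicit.
Unset Printing Implicit Defensive.

(* Finite simple graphs.  The link {u, v} is the two-element set [set u; v],
   and the port of v leading to the link {u, v} is named by the neighbor u. *)
Record sgraph := SGraph {
  vertex :> finType;
  adj : rel vertex;
  adj_sym : symmetric adj;
  adj_irr : irreflexive adj
}.

Section Graph.
Variable G : sgraph.

Definition links : {set {set G}} :=
  [set l | [exists u, exists v, adj u v && (l == [set u; v])]].

Definition nbrs (v : G) : {set G} := [set u | adj v u].

(* Adjacency in G \ D. *)
Definition adj_wo (D : {set {set G}}) : rel G :=
  fun u v => adj u v && ([set u; v] \notin D).

Definition up_nbrs (D : {set {set G}}) (v : G) : {set G} :=
  [set u | adj_wo D v u].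

Definition edge_connected (k : nat) : Prop :=
  1 < #|G| /\
  forall F : {set {set G}}, F \subset links -> #|F| < k ->
    forall u v : G, connect (adj_wo F) u v.

(* [f v p U] is the out-port chosen at v when the in-port is p ([None] if the
   packet originates at v) and U is the set of ports of v that are up. *)
Definition forwarding := G -> option G -> {set G} -> G.

(* The out-port is not required to be up: a packet sent over a link that is
   down is lost.  Nothing is asked of f when every link at v is down. *)
Definition routing_scheme (t : G) (f : forwarding) : Prop :=
  forall (v : G) (p : option G) (U : {set G}),
    v != t -> (forall u, p = Some u -> u \in nbrs v) ->
    U \subset nbrs v -> U != set0 -> f v p U \in nbrs v.

(* [rot (index u c).+1 c] lists the circular sequence c starting from the
   successor of u and ending with u itself; the packet leaves through the first
   port of this list that is up.  The in-port u need not be up. *)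
Definition link_circular (f : forwarding) (v : G) : Prop :=
  exists c : seq G,
    [/\ uniq c,
        c =i nbrs v
      & forall (u : G) (U : {set G}),
          u \in nbrs v -> U \subset nbrs v -> U != set0 ->
          f v (Some u) U = head v [seq w <- rot (index u c).+1 c | w \in U]].

(* [D n] is the set of links that are down when the packet makes its n-th hop.
   The result is the node holding the packet after n hops together with its
   in-port there, or [None] if the packet is lost; the packet stops at t. *)
Fixpoint packet (t : G) (f : forwarding) (D : nat -> {set {set G}}) (s : G)
    (n : nat) : option (G * option G) :=
  if n is m.+1 then
    if packet t f D s m is Some (v, p) then
      if v == t then Some (v, p) else
      let U := up_nbrs (D m) v in
      let u := f v p U in
      if u \in U then Some (u, Some v) else None
    else None
  else Some (s, None).

Definition delivered (t : G) (f : forwarding) (D : nat -> {set {set G}})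
    (s : G) : Prop :=
  exists n p, packet t f D s n = Some (t, p).

Definition dynamic_resilient (k : nat) (t : G) (f : forwarding) : Prop :=
  forall F : {set {set G}}, F \subset links -> #|F| <= k ->
  forall s : G, connect (adj_wo F) s t ->
  forall D : nat -> {set {set G}}, (forall n, D n \subset F) ->
    delivered t f D s.

End Graph.

(* Main.v *)
Require Import Defs.
From mathcomp Require Import all_boot.

Set Implicit Arguments.
Unset Strict Implicit.
Unset Printing Implicit Defensive.

(** The graph is K4 minus the edge {s, t}: the two hubs are adjacent to each
    other and to both s and t.  A packet from s can be kept forever in one of
    the two directed triangles s -> hub b -> hub (~~ b) -> s.  At each hub the
    circular order either sends packets from s to t first or to the other hub
    first.  If both hubs do the same, take for b the hub chosen at the origin s
    and keep the link from t to the one hub at which the packet would escape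
    down.  If they differ, one of the triangles is followed when all links are
    up, and the packet is driven into it by having the other link of s down
    only at the very first hop. *)

Section General.
Variable G : sgraph.
Implicit Types (D : {set {set G}}) (u v x y : G).

Lemma up_nbrs_sub D v : up_nbrs D v \subset nbrs v.
Proof. by apply/subsetP => u; rewrite !inE => /andP[]. Qed.

Lemma mem_up_nbrs D v u : (u \in up_nbrs D v) = adj v u && ([set v; u] \notin D).
Proof. by rewrite inE. Qed.

Lemma eq_link u v x y :
  ([set u; v] == [set x; y]) =
  [&& (u == x) || (u == y), (v == x) || (v == y),
      (x == u) || (x == v) & (y == u) || (y == v)].
Proof. by rewrite eqEsubset !subUset !sub1set !inE -!andbA. Qed.

Lemma link_in_links u v : adj u v -> [set [set u; v]] \subset links G.
Proof.
move=> uv; rewrite sub1set inE; apply/existsP; exists u; apply/existsP; exists v.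
by rewrite uv eqxx.
Qed.

(** At most one link is removed: if it is the side [x y] itself, the other two sides survive and
    give the detour through [z]. *)
Lemma connect_triangle D x y z : #|D| < 2 ->
  adj x y -> adj y z -> adj x z -> connect (adj_wo D) x y.
Proof.
rewrite ltnS => /card_le1_eqP D1 xy yz xz.
have ne u v : adj u v -> u != v.
  by move=> uv; apply: contraTneq uv => ->; rewrite adj_irr.
have [xyD|xyD] := boolP ([set x; y] \in D); last first.
  by apply: connect1; rewrite /adj_wo xy.
have up u v : adj u v -> [set u; v] != [set x; y] -> connect (adj_wo D) u v.
  move=> uv uvxy; apply: connect1; rewrite /adj_wo uv /=.
  by apply: contra uvxy => uvD; rewrite (D1 _ _ uvD xyD).
have [nxy nyz nxz] := And3 (ne _ _ xy) (ne _ _ yz) (ne _ _ xz).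
have zE : ((z == x) = false) * ((z == y) = false).
  by split; apply/negbTE; rewrite eq_sym.
apply: (connect_trans (up _ _ xz _) (up z y _ _)).
- by rewrite eq_link !zE andbF.
- by rewrite adj_sym.
- by rewrite eq_link !zE.
Qed.

(** A lost packet is not delivered either, so [P] only has to survive hops over links that are
    up. *)
Lemma invariant_not_delivered (t : G) (f : forwarding G) (D : nat -> {set {set G}})
    (s : G) (P : nat -> G -> option G -> Prop) :
  P 0 s None ->
  (forall n v p, P n v p -> v != t) ->
  (forall n v p, P n v p -> let u := f v p (up_nbrs (D n) v) in
     u \in up_nbrs (D n) v -> P n.+1 u (Some v)) ->
  ~ delivered t f D s.
Proof.
move=> P0 Pt PS.
have inv n : if packet t f D s n is Some (v, p) then P n v p else True.
  elim: n => [//|n] /=; case: packet => [[v p] Pn|//].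
  by rewrite (negPf (Pt _ _ _ Pn)); case: ifP => // /PS; apply.
by case=> n [p E]; have := inv n; rewrite E => /Pt; rewrite eqxx.
Qed.

End General.

(** The first component marks the hubs; only the two non-hubs are non-adjacent. *)
Definition diamond_adj : rel (bool * bool) :=
  fun u v => (u != v) && (u.1 || v.1).

Lemma diamond_adj_sym : symmetric diamond_adj.
Proof. by move=> u v; rewrite /diamond_adj eq_sym orbC. Qed.

Lemma diamond_adj_irr : irreflexive diamond_adj.
Proof. by move=> u; rewrite /diamond_adj eqxx. Qed.

Definition diamond : sgraph := SGraph diamond_adj_sym diamond_adj_irr.

Definition src : diamond := (false, true).
Definition dst : diamond := (false, false).
Definition hub (b : bool) : diamond := (true, b).

Lemma diamond_edge_connected : edge_connected diamond 2.
Proof.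
split=> [|F _ F2]; first by rewrite card_prod card_bool.
have conn (u v : diamond) : adj u v -> connect (adj_wo F) u v.
  move=> uv.
  (* Every link of the diamond lies in a triangle. *)
  have /existsP[w /andP[uw vw]] : [exists w, adj u w && adj v w].
    apply/existsP.
    move: u v uv => [[] []] [[] []] // _;
      by [exists (hub true) | exists (hub false) | exists src].
  exact: connect_triangle F2 uv vw uw.
move=> u v; have [->|uv] := eqVneq u v; first exact: connect0.
have [/conn//|nuv] := boolP (adj u v).
(* The remaining pair is [src] and [dst], with either hub as a common neighbor. *)
apply: (@connect_trans _ _ (hub true)); apply: conn;
  by move: u v uv nuv => [[] []] [[] []].
Qed.

Section Routing.
Variable f : forwarding diamond.

(** [l] is the preference list at [v] for in-port [u], namely the circular order read from just
    after [u]. *)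
Definition turns (v u : diamond) (l : seq diamond) : Prop :=
  forall U : {set diamond}, U \subset nbrs v -> U != set0 ->
    f v (Some u) U = head v [seq w <- l | w \in U].

Lemma turns_first_up v u l1 l2 D x : turns v u (l1 ++ x :: l2) ->
  x \in up_nbrs D v -> all (fun w => w \notin up_nbrs D v) l1 ->
  f v (Some u) (up_nbrs D v) = x.
Proof.
move=> T xU l1D; rewrite T ?up_nbrs_sub //; last by apply/set0Pn; exists x.
rewrite filter_cat (_ : [seq w <- l1 | _] = [::]) /= ?xU //.
by apply/eqP; rewrite -size_eq0 size_filter -leqn0 leqNgt -has_count -all_predC.
Qed.

(** Two ports admit a single circular order. *)
Lemma src_turns b : link_circular f src -> turns src (hub (~~ b)) [:: hub b; hub (~~ b)].
Proof.
case=> c [Uc Mc H] U sU U0; rewrite H //; last by rewrite inE.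
have: c \in permutations [:: hub b; hub (~~ b)].
  rewrite mem_permutations uniq_perm // => [|w]; first by case: b.
  by rewrite Mc !inE; move: b w => [] [[] []].
by case: b {H Mc}; vm_compute permutations; rewrite !inE => /orP[] /eqP->.
Qed.

(** The circular order [src], [dst], [hub (~~ b)]; [hub_first] is its reverse. In-port [dst] is left
    out because packets stop there. *)
Definition dst_first b : Prop :=
  turns (hub b) src [:: dst; hub (~~ b); src] /\
  turns (hub b) (hub (~~ b)) [:: src; dst; hub (~~ b)].
Definition hub_first b : Prop :=
  turns (hub b) src [:: hub (~~ b); dst; src] /\
  turns (hub b) (hub (~~ b)) [:: dst; src; hub (~~ b)].

(** The six listings of three ports are the rotations of just two circular orders. *)
Lemma hub_turns b : link_circular f (hub b) -> dst_first b \/ hub_first b.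
Proof.
case=> c [Uc Mc H].
have: c \in permutations [:: dst; hub (~~ b); src].
  rewrite mem_permutations uniq_perm // => w.
  by rewrite Mc !inE; move: b w {H Mc} => [] [[] []].
have T u : adj (hub b) u -> turns (hub b) u (rot (index u c).+1 c).
  by move=> bu U; apply: H; rewrite inE.
have [Ts Th] : turns (hub b) src (rot (index src c).+1 c) /\
    turns (hub b) (hub (~~ b)) (rot (index (hub (~~ b)) c).+1 c).
  by split; apply: T; case: (b).
case: b Ts Th {T H Mc} => Ts Th; vm_compute permutations; rewrite !inE;
  do ![case/orP] => /eqP Ec; rewrite {}Ec in Ts Th;
  by [left | right].
Qed.

(** Hop 0 is separate because the packet then has no in-port; if its chosen link is down, the packet
    is lost, which also prevents delivery. *)
Lemma triangle_not_delivered b (D : nat -> {set {set diamond}}) :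
  let up n := up_nbrs (D n) in
  (f src None (up 0 src) \in up 0 src -> f src None (up 0 src) = hub b) ->
  (forall n, f src (Some (hub (~~ b))) (up n.+1 src) = hub b) ->
  (forall n, f (hub b) (Some src) (up n.+1 (hub b)) = hub (~~ b)) ->
  (forall n, f (hub (~~ b)) (Some (hub b)) (up n.+1 (hub (~~ b))) = src) ->
  ~ delivered dst f D src.
Proof.
move=> up f0 fs fb fo.
apply: (@invariant_not_delivered _ _ _ _ _ (fun n v p =>
  if n is 0 then v = src /\ p = None else
  (v, p) \in [:: (src, Some (hub (~~ b))); (hub b, Some src);
                 (hub (~~ b), Some (hub b))])) => //.
- case=> [|n] v p; first by case=> ->.
  by rewrite !inE => /or3P[] /eqP[-> _]; case: (b).
- case=> [|n] v p; first by case=> -> -> /= /f0 ->; rewrite !inE eqxx orbT.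
  by rewrite !inE => /or3P[] /eqP[-> ->] /= _;
    rewrite ?[f _ _ _]fs ?[f _ _ _]fb ?[f _ _ _]fo !inE eqxx ?orbT.
Qed.

End Routing.

Theorem theorem7 :
  exists (G : sgraph) (t : G),
    edge_connected G 2 /\
    forall f : forwarding G,
      routing_scheme t f ->
      (forall v : G, v != t -> link_circular f v) ->
      ~ dynamic_resilient 1 t f.
Proof.
exists diamond, dst; split=> [|f rs lc res]; first exact: diamond_edge_connected.
have Ts b : turns f src (hub (~~ b)) [:: hub b; hub (~~ b)].
  by apply: src_turns; apply: lc.
(* Removing one link leaves [src] connected to [dst], so resilience promises delivery; each case
   below contradicts this. *)
have deliv (u v : diamond) (D : nat -> {set {set diamond}}) :
    adj u v -> (forall n, D n \subset [set [set u; v]]) -> delivered dst f D src.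
  move=> /link_in_links uvl; apply: res => //; first by rewrite cards1.
  by apply: (proj2 diamond_edge_connected) => //; rewrite cards1.
have differ b : hub_first f b -> dst_first f (~~ b) -> False.
  move=> [Tb _] [_ To]; rewrite negbK in To.
  pose D n : {set {set diamond}} := if n is 0 then [set [set src; hub (~~ b)]] else set0.
  have upE n v u : (u \in up_nbrs (D n.+1) v) = adj v u.
    by rewrite mem_up_nbrs inE andbT.
  apply: (@triangle_not_delivered f b D); last first.
  - by apply: (deliv src (hub (~~ b))) => // -[|n] //=; apply: sub0set.
  - by move=> n; apply: (turns_first_up (l1 := [::]) To); rewrite ?upE //; case: (b).
  - by move=> n; apply: (turns_first_up (l1 := [::]) Tb); rewrite ?upE //; case: (b).
  - by move=> n; apply: (turns_first_up (l1 := [::]) (Ts b)); rewrite ?upE //; case: (b).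
  (* At hop 0 the only port of [src] that is up is [hub b]. *)
  - rewrite /= inE /adj_wo inE eq_link; move: (f _ _ _) => [[] []] //; by case: (b).
have same b x : f src None (nbrs src) = hub b ->
    (x = b /\ dst_first f b /\ dst_first f (~~ b)) \/
    (x = ~~ b /\ hub_first f b /\ hub_first f (~~ b)) -> False.
  move=> f0 cases.
  (* This failure is permanent. With [dst_first] the escape is at [hub b], on arrival from [src];
     with [hub_first] it is at [hub (~~ b)], on arrival from [hub b]. *)
  pose D (n : nat) : {set {set diamond}} := [set [set hub x; dst]].
  have upE n v u : (u \in up_nbrs (D n) v) = adj v u && ([set v; u] != [set hub x; dst]).
    by rewrite mem_up_nbrs inE.
  (* The failed link misses [src], so the choice [f0] made with all ports up applies at the
     origin. *)
  have upsrc n : up_nbrs (D n) src = nbrs src.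
    by apply/setP=> u; rewrite upE inE eq_link; move: u x {f0 cases D upE} => [[] []] [].
  apply: (@triangle_not_delivered f b D); last first.
  - by apply: (deliv (hub x) dst).
  - move=> n; case: cases => -[Ex [_ [_ To]]]; rewrite negbK in To.
      by apply: (turns_first_up (l1 := [::]) To); rewrite ?upE ?eq_link ?Ex //; case: (b).
    by apply: (turns_first_up (l1 := [:: dst]) To);
      rewrite /= ?upE ?eq_link ?Ex //; case: (b).
  - move=> n; case: cases => -[Ex [[Tb _] _]].
      by apply: (turns_first_up (l1 := [:: dst]) Tb);
        rewrite /= ?upE ?eq_link ?Ex //; case: (b).
    by apply: (turns_first_up (l1 := [::]) Tb); rewrite ?upE ?eq_link ?Ex //; case: (b).
  - by move=> n; apply: (turns_first_up (l1 := [::]) (Ts b)); rewrite ?upE ?eq_link.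
  - by rewrite upsrc.
have [b f0] : exists b, f src None (nbrs src) = hub b.
  have: f src None (nbrs src) \in nbrs src.
    by apply: rs => //; apply/set0Pn; exists (hub true); rewrite inE.
  by rewrite inE; case: (f _ _ _) => [[] []] // _; [exists true | exists false].
have T c : dst_first f c \/ hub_first f c by apply: hub_turns; apply: lc.
have [Tb|Tb] := T b; have [To|To] := T (~~ b).
- by apply: (same b b f0); left.
- by apply: (differ (~~ b)); rewrite ?negbK.
- exact: (differ b).
- by apply: (same b (~~ b) f0); right.
Qed.
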